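(* Let $\mathcal{L}=(L,\leq)$ be a finite congruence-uniform lattice. If the core label order $\mathrm{CLO}(\mathcal{L})$ is a lattice, then $\mathcal{L}$ is spherical.
   Context: For a finite lattice $\mathcal{L}=(L,\leq)$, $\mathcal{J}(\mathcal{L})$ denotes the set of join-irreducible elements (elements $j\neq\hat{0}$ such that $j=x\vee y$ implies $j\in\{x,y\}$); each such $j$ has a unique lower cover $j_{*}$. For a cover relation $u\lessdot v$, $\mathrm{cg}(u,v)$ is the finest lattice congruence of $\mathcal{L}$ in which $u$ and $v$ are equivalent, and $\mathrm{cg}(j)=\mathrm{cg}(j_*,j)$. The join-irreducible elements of the congruence lattice $\mathrm{Con}(\mathcal{L})$ are exactly the congruences $\mathrm{cg}(j)$, $j\in\mathcal{J}(\mathcal{L})$. A finite lattice is congruence-uniform if the map $j\mapsto\mathrm{cg}(j)$ is a bijection from $\mathcal{J}(\mathcal{L})$ onto the join-irreducible congruences, both for $\mathcal{L}$ and for its dual $(L,\geq)$. In a congruence-uniform lattice, for a cover $u\lessdot v$ let $j_{\mathrm{cg}(u,v)}$ be the unique $j\in\mathcal{J}(\mathcal{L})$ with $\mathrm{cg}(j)=\mathrm{cg}(u,v)$. The nucleus of $x\in L$ is $x_{\downarrow}=\bigwedge\{y\in L\mid y\lessdot x\}$ (for $x=\hat{0}$ the core label set below is empty). The core label set of $x$ is $\Psi(x)=\{j_{\mathrm{cg}(u,v)}\mid x_{\downarrow}\leq u\lessdot v\leq x\}$. The core label order is $\mathrm{CLO}(\mathcal{L})=(L,\sqsubseteq)$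 where $x\sqsubseteq y$ iff $\Psi(x)\subseteq\Psi(y)$; this is a partial order. A bounded poset is spherical if the order complex of its proper part (the poset with $\hat0$ and $\hat1$ removed) is homotopy equivalent to a sphere. *)

(* Defs.v *)
From HB Require Import structures.
From mathcomp Require Import all_boot all_order all_algebra.

Set Implicit Arguments.
Unset Strict Implicit.
Unset Printing Implicit Defensive.

Import Order.TTheory.

Section Covers.
Local Open Scope order_scope.
Context (d : Order.disp_t) (P : finPOrderType d).

Definition covers (u v : P) : bool :=
  (u < v) && ~~ [exists w : P, (u < w) && (w < v)].

End Covers.

Section Congruences.
Local Open Scope order_scope.
Context (d : Order.disp_t) (L : finTBLatticeType d).

Definition join_irreducible (j : L) : bool :=
  (j != \bot) && [forall x : L, forall y : L,
    (j == x `|` y) ==> ((j == x) || (j == y))].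

(* When [j] is join-irreducible it has exactly one lower cover, so the choice
   made by [pick] is forced and the default value is not used; see
   [join_irreducible_covers] below. *)
Definition lower_cover (j : L) : L := odflt j [pick u | covers u j].

Definition congruence (R : {set L * L}) : bool :=
  [&& [forall x : L, (x, x) \in R],
      [forall x : L, forall y : L, ((x, y) \in R) ==> ((y, x) \in R)],
      [forall x : L, forall y : L, forall z : L,
        ((x, y) \in R) && ((y, z) \in R) ==> ((x, z) \in R)] &
      [forall x : L, forall x' : L, forall y : L, forall y' : L,
        ((x, x') \in R) && ((y, y') \in R) ==>
        ((x `&` y, x' `&` y') \in R) && ((x `|` y, x' `|` y') \in R)]].

Definition congruence_generated (A : {set L * L}) : {set L * L} :=
  \bigcap_(R : {set L * L} | congruence R && (A \subset R)) R.

Definition cg (u v : L) : {set L * L} := congruence_generated [set (u, v)].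

Definition cg_irr (j : L) : {set L * L} := cg (lower_cover j) j.

(* Join-irreducible elements of Con(L): its least element is the equality
   relation, and the join of two congruences is generated by their union. *)
Definition join_irreducible_congruence (R : {set L * L}) : bool :=
  [&& congruence R, R != [set p | p.1 == p.2] &
      [forall S : {set L * L}, forall T : {set L * L},
        [&& congruence S, congruence T & R == congruence_generated (S :|: T)]
        ==> ((R == S) || (R == T))]].

Definition cg_irr_bijective : Prop :=
  {in [set j | join_irreducible j] &, injective cg_irr} /\
  cg_irr @: [set j | join_irreducible j] =
    [set R | join_irreducible_congruence R].

End Congruences.

Section LowerCover.
Local Open Scope order_scope.
Context (d : Order.disp_t) (L : finTBLatticeType d).

Lemma covers_above (x y : L) : x < y -> exists2 u, covers u y & x <= u.
Proof.
move=> xy; pose B z := [set w : L | (z < w) && (w < y)].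
have [n] := ubnP #|B x|; elim: n x xy => // n IH x xy; rewrite ltnS => le_n.
have [/existsP[w /andP[xw wy]]|nw] := boolP [exists w, (x < w) && (w < y)].
  have [|u uy wu] := IH w wy; last first.
    by exists u => //; apply: le_trans wu; apply: ltW.
  apply: leq_trans le_n; apply: proper_card; apply/properP; split.
    apply/subsetP => z; rewrite !inE => /andP[wz ->]; rewrite andbT.
    exact: lt_trans wz.
  by exists w; rewrite !inE ?xw ?wy ?ltxx.
by exists x => //; rewrite /covers xy nw.
Qed.

Lemma join_irreducible_covers (j u : L) :
  join_irreducible j -> covers u j = (u == lower_cover j).
Proof.
move=> /andP[j0 /forallP jP]; rewrite /lower_cover.
case: pickP => [v vj|none] /=; last first.
  by have [|w] := @covers_above \bot j; rewrite ?lt0x // none.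
have cu (w w' : L) : covers w j -> covers w' j -> w <= w'.
  move=> /andP[wj _] /andP[w'j nw'].
  have: w `|` w' <= j by rewrite leUx !ltW.
  rewrite le_eqVlt => /orP[/eqP e|lt].
    have /forallP/(_ w') := jP w; rewrite e eqxx /= => /orP[] /eqP e'.
      by rewrite e' ltxx in wj.
    by rewrite e' ltxx in w'j.
  have := leUr w' w; rewrite le_eqVlt => /orP[/eqP ->|lt']; first exact: leUl.
  by case/negP: nw'; apply/existsP; exists (w `|` w'); rewrite lt'.
apply/idP/eqP => [uj|-> //]; apply: le_anti; rewrite !cu //.
Qed.

End LowerCover.

Definition congruence_uniform (d : Order.disp_t) (L : finTBLatticeType d) :=
  cg_irr_bijective L /\ cg_irr_bijective L^d.

Section CoreLabelOrder.
Local Open Scope order_scope.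
Context (d : Order.disp_t) (L : finTBLatticeType d).

(* [nucleus \bot] is the empty meet [\top]; then no cover [u], [v] satisfies
   [nucleus \bot <= u] and [v <= \bot], so that [core_labels \bot] is empty. *)
Definition nucleus (x : L) : L := \meet_(y : L | covers y x) y.

Definition core_labels (x : L) : {set L} :=
  [set j : L | join_irreducible j && [exists u : L, exists v : L,
    [&& nucleus x <= u, covers u v, v <= x & cg_irr j == cg u v]]].

Definition clo (x y : L) : bool := core_labels x \subset core_labels y.

End CoreLabelOrder.

Definition is_meet (T : Type) (le : rel T) (x y m : T) : Prop :=
  [/\ le m x, le m y & forall z, le z x -> le z y -> le z m].

Definition is_join (T : Type) (le : rel T) (x y m : T) : Prop :=
  [/\ le x m, le y m & forall z, le x z -> le y z -> le m z].

(* The order axioms are not part of this predicate: [clo] is reflexive and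
   transitive by definition, and it is antisymmetric when [L] is
   congruence-uniform. *)
Definition is_lattice (T : Type) (le : rel T) : Prop :=
  forall x y, (exists m, is_meet le x y m) /\ (exists m, is_join le x y m).

Section OrderComplex.
Local Open Scope order_scope.
Context (d : Order.disp_t).

Definition proper_part (P : finTBPOrderType d) : {set P} :=
  [set x | (x != \bot) && (x != \top)].

(* The nonempty chains contained in [A]. *)
Definition order_complex (P : finPOrderType d) (A : {set P}) :
    {set {set P}} :=
  [set C : {set P} | [&& C != set0, C \subset A &
    [forall x in C, forall y in C, (x <= y) || (y <= x)]]].

End OrderComplex.

From mathcomp Require Import all_classical all_reals all_analysis.
Import GRing.Theory Num.Theory numFieldNormedType.Exports.

Section Homotopy.
Local Open Scope ring_scope.
Local Open Scope classical_set_scope.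
Context (R : realType).

(* Subsets [A] and [B] carry the subspace topology, and maps from [A] to [B]
   are represented by total functions considered on [A] only. *)
Definition homotopic (X Y : topologicalType) (A : set X) (B : set Y)
    (f g : X -> Y) : Prop :=
  exists H : X * R -> Y,
    [/\ {within A `*` `[0, 1], continuous H},
        set_fun (A `*` `[0, 1]) B H,
        (forall x, A x -> H (x, 0) = f x) &
        (forall x, A x -> H (x, 1) = g x)].

Definition homotopy_equivalent (X Y : topologicalType)
    (A : set X) (B : set Y) : Prop :=
  exists (f : X -> Y) (g : Y -> X),
    [/\ {within A, continuous f} /\ set_fun A B f,
        {within B, continuous g} /\ set_fun B A g,
        homotopic A A (g \o f) id &
        homotopic B B (f \o g) id].

(* Barycentric coordinates; the index set is finite, so pointwise convergence
   is the Euclidean topology. *)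
Definition geometric_realization (T : finType) (K : {set {set T}}) :
    set {ptws T -> R} :=
  [set t : {ptws T -> R} | [/\ forall x, 0 <= t x, \sum_x t x = 1 &
    [set x | t x != 0]%SET \in K]].

(* The unit sphere of R^n, of dimension n - 1; it is empty for n = 0. *)
Definition unit_sphere (n : nat) : set 'rV[R]_n :=
  [set v | \sum_i v ord0 i ^+ 2 = 1].

Definition spherical (d : Order.disp_t) (P : finTBPOrderType d) : Prop :=
  exists n : nat, homotopy_equivalent
    (geometric_realization (order_complex (proper_part P))) (@unit_sphere n).

End Homotopy.

(* Main.v *)
(* The greatest element [t] of the core label order has every join-irreducible
   among its labels. In a congruence-uniform lattice the label of a cover
   [u], [v] is the least element below [v] and not below [u]. Applied to the
   atoms this gives [nucleus t = \bot]; applied dually to the coatoms it gives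
   [t = \top]. Hence the coatoms meet to [\bot], while no proper subset of them
   does: the least element not below a coatom [c] lies below all the others.

   The order complex is then a sphere by an explicit crosscut argument. A point
   of the complex is a convex combination [t] of a chain, and its level at a
   coatom [c] is the mass lying below [c]; the level vectors are never constant,
   so modulo constants and positive scaling they are points of a sphere.
   Conversely, the strict superlevel sets of a nonconstant vector indexed by the
   coatoms form a chain of nonempty proper subsets, whose meets span a simplex
   of the order complex. *)

Require Import Defs.
From mathcomp Require Import all_boot all_order all_algebra.

Set Implicit Arguments.
Unset Strict Implicit.
Unset Printing Implicit Defensive.

Import Order.TTheory.

(** * Labels of covers *)

Section Labels.
Local Open Scope order_scope.
Context (d : Order.disp_t) (L : finTBLatticeType d).
Implicit Types (u v j x y a : L) (R : {set L * L}).

Lemma congruenceP R : reflect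
  [/\ forall x, (x, x) \in R, forall x y, (x, y) \in R -> (y, x) \in R,
      forall x y z, (x, y) \in R -> (y, z) \in R -> (x, z) \in R &
      forall x x' y y', (x, x') \in R -> (y, y') \in R ->
        (x `&` y, x' `&` y') \in R /\ (x `|` y, x' `|` y') \in R]
  (congruence R).
Proof.
apply: (iffP and4P) => [[r s t c]|[r s t c]].
  split=> [x|x y xy|x y z xy yz|x x' y y' xx yy]; first exact: (forallP r).
  - by move: s => /forallP/(_ x)/forallP/(_ y)/implyP; apply.
  - move: t => /forallP/(_ x)/forallP/(_ y)/forallP/(_ z)/implyP; apply.
    by rewrite xy yz.
  - move: c => /forallP/(_ x)/forallP/(_ x')/forallP/(_ y)/forallP/(_ y').
    by rewrite xx yy => /andP.
split; apply/forallP => x //; apply/forallP => y.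
- by apply/implyP; apply: s.
- by apply/forallP => z; apply/implyP => /andP[]; apply: t.
- apply/forallP => z; apply/forallP => w.
  by apply/implyP => /andP[xy zw]; apply/andP; apply: c.
Qed.

Lemma mem_congruence_generated (A : {set L * L}) p :
  reflect (forall R, congruence R -> A \subset R -> p \in R)
    (p \in congruence_generated A).
Proof.
apply: (iffP bigcapP) => [h R cR AR|h R /andP[]]; last exact: h.
by apply: h; rewrite cR.
Qed.

Lemma congruence_cg u v : congruence (cg u v).
Proof.
apply/congruenceP; split=> [x|x y|x y z|x x' y y'].
- by apply/mem_congruence_generated => R /congruenceP[].
- move=> /mem_congruence_generated h; apply/mem_congruence_generated => R cR uvR.
  by have /congruenceP[_ s _ _] := cR; apply/s/h.
- move=> /mem_congruence_generated h /mem_congruence_generated k.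
  apply/mem_congruence_generated => R cR uvR.
  by have /congruenceP[_ _ t _] := cR; apply: t (h _ cR uvR) (k _ cR uvR).
- move=> /mem_congruence_generated h /mem_congruence_generated k; split.
    apply/mem_congruence_generated => R cR uvR.
    by have /congruenceP[_ _ _ c] := cR; case: (c _ _ _ _ (h _ cR uvR) (k _ cR uvR)).
  apply/mem_congruence_generated => R cR uvR.
  by have /congruenceP[_ _ _ c] := cR; case: (c _ _ _ _ (h _ cR uvR) (k _ cR uvR)).
Qed.

Lemma mem_cg u v : (u, v) \in cg u v.
Proof. by apply/mem_congruence_generated => R _; rewrite sub1set. Qed.

Lemma cg_sub u v R : congruence R -> (u, v) \in R -> cg u v \subset R.
Proof.
move=> cR uvR; apply/subsetP => p /mem_congruence_generated; apply=> //.
by rewrite sub1set.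
Qed.

(** Each pair yields the other: joining [(u, v)] with [x] gives [(x, y)] by absorption, and meeting
    [(x, y)] with [v] gives [(u, v)]. *)
Lemma cg_perspective u v x y :
  x `&` v = u -> x `|` v = y -> cg u v = cg x y.
Proof.
move=> <- <-; apply/eqP; rewrite eqEsubset.
apply/andP; split; apply: cg_sub; rewrite ?congruence_cg //.
  have /congruenceP[r _ _ c] := congruence_cg x (x `|` v).
  by have [] := c _ _ _ _ (mem_cg x (x `|` v)) (r v); rewrite (meet_r (leUr v x)).
have /congruenceP[r _ _ c] := congruence_cg (x `&` v) v.
by have [_] := c _ _ _ _ (r x) (mem_cg (x `&` v) v); rewrite meetKU.
Qed.

Lemma covers_join u v x : covers u v -> x <= v -> ~~ (x <= u) -> x `|` u = v.
Proof.
case/andP=> uv /existsPn h xv xu; apply/eqP; move: (h (x `|` u)).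
have le : x `|` u <= v by rewrite leUx xv ltW.
rewrite eq_le le /= negb_and; case/orP.
  by rewrite lt_neqAle leUr andbT negbK => /eqP e; rewrite e leUl in xu.
by rewrite lt_neqAle le andbT negbK => /eqP ->.
Qed.

(* A minimal [j] with [j <= v] and [~~ (j <= u)] is join-irreducible, and its
   cover is perspective to [u], [v]. *)
Lemma label_below u v x : covers u v -> x <= v -> ~~ (x <= u) ->
  exists j, [/\ join_irreducible j, cg_irr j = cg u v, j <= x & ~~ (j <= u)].
Proof.
move=> uv xv xu.
have [j /andP[jx ju] jmin] : exists2 j, (j <= x) && ~~ (j <= u) &
    forall y, y < j -> y <= u.
  pose B z := [set w : L | w < z].
  have [n] := ubnP #|B x|; elim: n x xv xu => // n IH x xv xu; rewrite ltnS => le_n.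
  have [/existsP[w /andP[wx wu]]|] := boolP [exists w, (w < x) && ~~ (w <= u)].
    have [|||j /andP[jw ju] jmin] := IH w.
    - exact: le_trans (ltW wx) xv.
    - exact: wu.
    - apply: leq_trans le_n; apply: proper_card; apply/properP; split.
        by apply/subsetP => z; rewrite !inE => /lt_trans; apply.
      by exists w; rewrite !inE ?wx ?ltxx.
    by exists j => //; rewrite ju (le_trans jw (ltW wx)).
  move=> /existsPn h; exists x; first by rewrite lexx.
  by move=> y yx; move: (h y); rewrite yx /= negbK.
have Jj : join_irreducible j.
  apply/andP; split; first by apply: contraNneq ju => ->; rewrite le0x.
  apply/forallP => y; apply/forallP => z; apply/implyP => /eqP e.
  apply/norP => -[jy jz]; case/negP: ju; rewrite e leUx.
  by rewrite !jmin // lt_neqAle eq_sym ?jy ?jz e ?leUl ?leUr.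
exists j; split=> //.
have cj : covers (lower_cover j) j by rewrite join_irreducible_covers.
have jv : j <= v := le_trans jx xv.
apply: cg_perspective; last by rewrite joinC; apply: covers_join ju.
have /andP[lj /existsPn nj] := cj.
apply/eqP; rewrite eq_sym; move: (nj (u `&` j)).
have lu : lower_cover j <= u `&` j by rewrite lexI (ltW lj) jmin.
rewrite negb_and => /orP[]; first by rewrite lt_neqAle lu andbT negbK.
by rewrite lt_neqAle leIr andbT negbK => /eqP e; rewrite -e leIl in ju.
Qed.

Hypothesis injL : {in [set j | join_irreducible j] &, injective (@cg_irr d L)}.

(** [label_below] finds below [x] a join-irreducible with the congruence of the cover, and
    injectivity of [cg_irr] identifies it with [j]. *)
Lemma label_min u v j : covers u v -> join_irreducible j ->
  cg_irr j = cg u v -> forall x, x <= v -> ~~ (x <= u) -> j <= x.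
Proof.
move=> uv Jj ej x xv xu; have [k [Jk ek kx ku]] := label_below uv xv xu.
by rewrite (injL _ _ (etrans ej (esym ek))) ?inE.
Qed.

Lemma label_not_le u v j : covers u v -> join_irreducible j ->
  cg_irr j = cg u v -> ~~ (j <= u).
Proof.
move=> uv Jj ej; have nvu : ~~ (v <= u) by case/andP: uv => uv _; rewrite lt_geF.
have [k [Jk ek kx ku]] := label_below uv (lexx v) nvu.
by rewrite (injL _ _ (etrans ej (esym ek))) ?inE.
Qed.

Lemma label_le u v j : covers u v -> join_irreducible j ->
  cg_irr j = cg u v -> j <= v.
Proof.
move=> uv Jj ej; apply: (label_min uv Jj ej (lexx _)).
by case/andP: uv => uv _; rewrite lt_geF.
Qed.

Lemma atom_join_irreducible a : covers \bot a ->
  join_irreducible a /\ cg_irr a = cg \bot a.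
Proof.
move=> ca; have /andP[a0 _] := ca.
have [|j [Jj _ ja j0]] := label_below ca (lexx _); first by rewrite lt_geF.
have ea : a = j.
  by rewrite -(covers_join ca ja j0) joinx0.
rewrite {1}ea; split=> //; rewrite /cg_irr.
by move: ca; rewrite join_irreducible_covers ?ea // => /eqP <-.
Qed.

(** An atom is the label of its own cover, hence the label of every cover with the same
    congruence. *)
Lemma atom_label a u v : covers \bot a -> covers u v -> cg u v = cg \bot a ->
  a <= v /\ ~~ (a <= u).
Proof.
move=> /atom_join_irreducible[Ja ea] uv e; rewrite -{}e in ea.
by split; [apply: label_le ea|apply: label_not_le ea].
Qed.

End Labels.

(** * Passage to the dual lattice *)

Section Dual.
Local Open Scope order_scope.
Context (d : Order.disp_t) (L : finTBLatticeType d).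

Lemma covers_dual (u v : L) : covers (v : L^d) (u : L^d) = covers u v.
Proof.
rewrite /covers; congr (_ && ~~ _); apply/existsP/existsP => -[w];
  by rewrite andbC => h; exists w.
Qed.

Lemma congruence_to_dual (R : {set L * L}) : congruence R ->
  @congruence _ L^d [set p : L^d * L^d | ((p.1 : L), (p.2 : L)) \in R].
Proof.
move=> /congruenceP[r s t c]; apply/congruenceP; split.
- by move=> x; rewrite inE; apply: r.
- by move=> x y; rewrite !inE; apply: s.
- by move=> x y z; rewrite !inE; apply: t.
- by move=> x x' y y'; rewrite !inE => xx yy; have [] := c _ _ _ _ xx yy.
Qed.

Lemma congruence_of_dual (R : {set L^d * L^d}) : @congruence _ L^d R ->
  congruence [set p : L * L | ((p.1 : L^d), (p.2 : L^d)) \in R].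
Proof.
move=> /congruenceP[r s t c]; apply/congruenceP; split.
- by move=> x; rewrite inE; apply: r.
- by move=> x y; rewrite !inE; apply: s.
- by move=> x y z; rewrite !inE; apply: t.
- by move=> x x' y y'; rewrite !inE => xx yy; have [] := c _ _ _ _ xx yy.
Qed.

(** Duality exchanges the two compatibility conditions, so [L] and [L^d] have the same congruences;
    symmetry accounts for the reversed pair. *)
Lemma mem_cg_dual (u v x y : L) :
  ((x : L^d, y : L^d) \in @cg _ L^d v u) = ((x, y) \in cg u v).
Proof.
apply/idP/idP.
  move=> /mem_congruence_generated h.
  have := h _ (congruence_to_dual (congruence_cg u v)).
  rewrite sub1set !inE /=; apply.
  by have /congruenceP[_ s _ _] := congruence_cg u v; apply/s/mem_cg.
move=> /mem_congruence_generated h.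
have := h _ (congruence_of_dual (@congruence_cg _ L^d v u)).
rewrite sub1set !inE /=; apply.
by have /congruenceP[_ s _ _] := @congruence_cg _ L^d v u; apply/s/mem_cg.
Qed.

Lemma covers_below (x y : L) : x < y -> exists2 u, covers x u & u <= y.
Proof.
move=> xy; have [|u] := @covers_above _ L^d y x; first by [].
by rewrite covers_dual => xu uy; exists u.
Qed.

(** This is [atom_label] in [L^d]. Congruences are compared instead of labels, since one congruence
    has in general different labels in [L] and in [L^d]. *)
Lemma coatom_label (m u v : L) :
  {in [set j | join_irreducible j] &, injective (@cg_irr _ L^d)} ->
  covers m \top -> covers u v -> cg u v = cg m \top -> u <= m /\ ~~ (v <= m).
Proof.
move=> injd cm cuv e.
apply: (@atom_label _ L^d injd m v u); rewrite ?covers_dual //.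
by apply/setP => -[x y]; rewrite (mem_cg_dual u v) (mem_cg_dual m \top) e.
Qed.

End Dual.

(** * Core labels, the nucleus of the top, and meets of coatoms *)

Section CoreLabel.
Local Open Scope order_scope.
Context (d : Order.disp_t) (L : finTBLatticeType d).

Lemma join_irreducible_core_label (j : L) :
  join_irreducible j -> j \in core_labels j.
Proof.
move=> Jj; rewrite inE Jj /=; apply/existsP; exists (lower_cover j).
apply/existsP; exists j; rewrite lexx eqxx join_irreducible_covers // eqxx /=.
rewrite andbT; apply: meets_inf; by rewrite join_irreducible_covers.
Qed.

(** Binary joins taken along an enumeration give a bound for all elements; [x0] is the bound for the
    empty list. *)
Lemma lattice_has_top (T : finType) (le : rel T) (x0 : T) :
  reflexive le -> transitive le -> is_lattice le -> exists t, forall x, le x t.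
Proof.
move=> rle tle lat.
suff [t ht] : exists t, forall x, x \in enum T -> le x t.
  by exists t => x; apply: ht; rewrite mem_enum.
elim: (enum T) => [|y s [t ht]]; first by exists x0.
have [_ [m [ym tm _]]] := lat y t; exists m => x; rewrite inE => /orP[/eqP->//|xs].
exact: tle (ht _ xs) tm.
Qed.

Lemma nucleus_top : congruence_uniform L -> is_lattice (@clo d L) ->
  nucleus (\top : L) = \bot.
Proof.
move=> [[injL _] [injd _]] lat.
have [||t ht] := lattice_has_top \bot _ _ lat.
- by move=> x; apply: subxx.
- by move=> x y z; apply: subset_trans.
have lab (j : L) : join_irreducible j -> exists u v,
    [/\ nucleus t <= u, covers u v, v <= t & cg_irr j = cg u v].
  move=> Jj; have /subsetP/(_ _ (join_irreducible_core_label Jj)) := ht j.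
  rewrite inE Jj => /existsP[u /existsP[v /and4P[? ? ? /eqP ?]]].
  by exists u, v.
(* Otherwise [t] lies below a coatom [m]. The label of the cover [m], [\top] also labels a cover
   whose upper end satisfies [v <= t <= m], whereas [coatom_label] forbids [v <= m]. *)
have tT : t = \top.
  apply/eqP; apply/negPn/negP => tT.
  have [|m cm tm] := @covers_above _ L t \top; first by rewrite ltx1.
  have [|j [Jj ej _ _]] := label_below cm (lexx _); first by case/andP: cm => /lt_geF ->.
  have [u [v [_ cuv vt e]]] := lab j Jj.
  have [|_ /negP[]] := coatom_label injd cm cuv; first by rewrite -e ej.
  exact: le_trans vt tm.
(* An atom below the nucleus would be below the lower end of every cover in the core; but it labels
   one of these covers, so it is not below that lower end. *)
rewrite -tT; apply/eqP; apply/negPn/negP => n0.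
have [|a ca an] := @covers_below _ L \bot (nucleus t); first by rewrite lt0x.
have [Ja ea] := atom_join_irreducible ca.
have [u [v [nu cuv vt e]]] := lab a Ja.
have [|_ /negP[]] := atom_label injL ca cuv; first by rewrite -e ea.
exact: le_trans an nu.
Qed.

(** For [i] outside [S], the label of the cover [e i], [\top] is below every other [e k], hence
    below the meet, but not below [e i]. *)
Lemma coatom_meet (I : finType) (S : {set I}) (e : I -> L) (i : I) :
  {in [set j | join_irreducible j] &, injective (@cg_irr d L)} ->
  injective e -> (forall k, covers (e k) \top) ->
  (\meet_(k in S) e k <= e i) = (i \in S).
Proof.
move=> injL inje ce; apply/idP/idP => [|iS]; last exact: meets_inf.
apply: contraLR => niS.
have [|j [Jj ej _ je]] := label_below (ce i) (lexx _).
  by have /andP[/lt_geF->] := ce i.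
apply: contra je; apply: le_trans; apply/meetsP => k kS.
apply: label_min (ce i) Jj ej _ (lex1 _) _ => //.
(* Comparable coatoms coincide, so [e k <= e i] would give [k = i]. *)
apply/negP => ki; have /andP[ki' /existsPn/(_ (e i))] := ce k.
have /andP[-> _] := ce i; rewrite andbT lt_neqAle ki andbT negbK => /eqP/inje e'.
by rewrite -e' kS in niS.
Qed.

End CoreLabel.

From mathcomp Require Import lra.
From mathcomp Require Import all_classical all_reals all_analysis.
Import GRing.Theory Num.Theory numFieldNormedType.Exports.

(** * The crosscut complex of the coatoms *)

Lemma ltr_convex (R : realFieldType) (a x y x' y' : R) : (0 <= a <= 1)%R ->
  (x < x' -> y < y' -> (1 - a) * x + a * y < (1 - a) * x' + a * y')%R.
Proof.
case/andP; rewrite le_eqVlt => /orP[/eqP<- _ xx yy|a0 a1 xx yy]; first by lra.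
by rewrite ler_ltD ?ltr_pM2l // ler_wpM2l ?subr_ge0 // ltW.
Qed.

Section Crosscut.
Local Open Scope ring_scope.
Context (R : realType) (d : Order.disp_t) (P : finTBLatticeType d).
Context (m : nat) (e : 'I_m.+1 -> P).
Implicit Types (v : 'rV[R]_m) (S T : {set 'I_m.+1}) (s : 'I_m.+1 -> R) (t : P -> R) (x y z : P).

Definition above x : {set 'I_m.+1} := [set i | (x <= e i)%O]%SET.

Definition meet_of S : P := (\meet_(i in S) e i)%O.

Definition nontrivial S : bool := (S != finset.set0) && (S != [set: 'I_m.+1]%SET).

(** The closure operator of the Galois connection between [above] and [meet_of]. *)
Definition crosscut_closure x : P := meet_of (above x).

Definition level t (i : 'I_m.+1) : R := \sum_(x | (x <= e i)%O) t x.

(* Positive exactly when [S] is a strict superlevel set of [s]. *)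
Definition weight s S : R :=
  \prod_(i in S) \prod_(j | j \notin S) Num.max 0 (s i - s j).

Definition total_weight s : R := \sum_(S | nontrivial S) weight s S.

(** The normalised weights, transported along [meet_of] to the elements of [P]. *)
Definition bary s x : R :=
  (\sum_(S | nontrivial S && (meet_of S == x)) weight s S) / total_weight s.

Definition carried t : Prop :=
  [/\ forall x, 0 <= t x, \sum_x t x = 1,
      forall x, t x != 0 -> x \in proper_part P &
      forall x y, t x != 0 -> t y != 0 -> (x <= y)%O || (y <= x)%O].

Lemma carriedP t :
  @geometric_realization R P (order_complex (proper_part P)) t <-> carried t.
Proof.
split=> -[t0 t1].
  rewrite inE => /and3P[_ /fintype.subsetP tP /forallP tC]; split=> // x; first move=> tx.
    by apply: tP; rewrite inE.
  move=> y tx ty; move: (tC x); rewrite inE tx /= => /forallP/(_ y).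
  by rewrite inE ty.
move=> tP tC; split=> //; rewrite inE; apply/and3P; split.
- apply/negP => /eqP t_eq0; have /eqP := t1; rewrite big1 ?(eq_sym 0) ?oner_eq0 // => x _.
  by apply/eqP; apply/negPn/negP => tx; have := finset.in_set0 x; rewrite -t_eq0 inE tx.
- by apply/fintype.subsetP => x; rewrite inE; apply: tP.
- apply/forallP => x; apply/implyP; rewrite inE => tx.
  by apply/forallP => y; apply/implyP; rewrite inE => ty; apply: tC.
Qed.

(** The two supports together form a chain, so the whole segment lies in one simplex. *)
Lemma carried_convex t t' a : carried t -> carried t' -> 0 <= a <= 1 ->
  (forall x y, t x != 0 -> t' y != 0 -> (x <= y)%O || (y <= x)%O) ->
  carried (fun x => (1 - a) * t x + a * t' x).
Proof.
move=> [t0 t1 tP tC] [t'0 t'1 t'P t'C] /andP[a0 a1] tt'.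
have a10 : 0 <= 1 - a by rewrite subr_ge0.
have supp x : (1 - a) * t x + a * t' x != 0 -> t x != 0 \/ t' x != 0.
  have [->|] := eqVneq (t x) 0; last by left.
  have [->|] := eqVneq (t' x) 0; last by right.
  by rewrite !mulr0 addr0 eqxx.
split.
- by move=> x; rewrite addr_ge0 // mulr_ge0.
- by rewrite big_split /= -!mulr_sumr t1 t'1 !mulr1 subrK.
- by move=> x /supp[]; [apply: tP|apply: t'P].
- move=> x y /supp[] hx /supp[] hy; [exact: tC|exact: tt'| |exact: t'C].
  by rewrite orbC tt'.
Qed.

(** * Weights of superlevel sets *)

Lemma weight_ge0 s S : 0 <= weight s S.
Proof.
by rewrite prodr_ge0 // => i _; rewrite prodr_ge0 // => j _; rewrite le_max lexx.
Qed.

Lemma weight_neq0 s S i j :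
  weight s S != 0 -> i \in S -> j \notin S -> s j < s i.
Proof.
move=> w iS jS; move: w; rewrite /weight (bigD1 i) //= (bigD1 j) //= !mulf_eq0 !negb_or.
case/andP => /andP[+ _] _; apply: contraNT; rewrite -leNgt => ij.
by rewrite max_l // subr_le0.
Qed.

Lemma weight_gt0 s S :
  (forall i j, i \in S -> j \notin S -> s j < s i) -> 0 < weight s S.
Proof.
move=> h; rewrite prodr_gt0 // => i iS; rewrite prodr_gt0 // => j jS.
by rewrite lt_max subr_gt0 h // orbT.
Qed.

(** The set of indices with value above [s i] contains [j] but not [i], and its weight is
    positive. *)
Lemma total_weight_gt0 s i j : s i < s j -> 0 < total_weight s.
Proof.
move=> ij; pose S := [set k | s i < s k]%SET.
have pS : nontrivial S.
  apply/andP; split.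
    by apply/negP => /eqP S0; have := finset.in_set0 j; rewrite -S0 inE ij.
  by apply/negP => /eqP ST; have := finset.in_setT i; rewrite -ST inE ltxx.
rewrite /total_weight (bigD1 S) //= ltr_pwDl ?sumr_ge0 // => [|T _].
  apply: weight_gt0 => k l; rewrite !inE -leNgt => ik li.
  exact: le_lt_trans ik.
exact: weight_ge0.
Qed.

Lemma bary_supp s x : bary s x != 0 ->
  exists S, [/\ nontrivial S, meet_of S = x & weight s S != 0].
Proof.
rewrite mulf_eq0 negb_or => /andP[h _].
suff /existsP[S /and3P[pS /eqP mS wS]] :
  [exists S, [&& nontrivial S, meet_of S == x & weight s S != 0]] by exists S.
apply: contraNT h => /existsPn h; apply/eqP; apply: big1 => S /andP[pS mS].
by move: (h S); rewrite pS mS /= negbK => /eqP.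
Qed.

(** * Meets of subfamilies, the closure operator, and levels *)

Lemma meet_of_anti S T : S \subset T -> (meet_of T <= meet_of S)%O.
Proof.
move=> /fintype.subsetP ST; apply/meetsP => i iS; apply: meets_inf; exact: ST.
Qed.

Lemma above_anti x y : (x <= y)%O -> above y \subset above x.
Proof. by move=> xy; apply/fintype.subsetP => i; rewrite !inE; apply: le_trans. Qed.

Lemma closure_homo x y :
  (x <= y)%O -> (crosscut_closure x <= crosscut_closure y)%O.
Proof. by move=> /above_anti/meet_of_anti. Qed.

Lemma le_closure x : (x <= crosscut_closure x)%O.
Proof. by apply/meetsP => i; rewrite inE. Qed.

(** Excluding simultaneous witnesses in the two differences makes the sets nested, and [meet_of]
    reverses inclusion. *)
Lemma meet_of_comparable S T :
  (forall i j, i \in S -> i \notin T -> j \in T -> j \notin S -> False) ->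
  (meet_of S <= meet_of T)%O || (meet_of T <= meet_of S)%O.
Proof.
move=> h; have [ST|/subsetPn[i iS iT]] := boolP (S \subset T).
  by rewrite (meet_of_anti ST) orbT.
rewrite meet_of_anti //; apply/fintype.subsetP => j jT.
by apply/negPn/negP => jS; apply: h iS iT jT jS.
Qed.

(** Together the three hypotheses make the crosscut complex the boundary of a simplex with [m.+1]
    vertices. They hold vacuously when no set is nontrivial and the proper part is empty, which
    covers the one-element lattice. *)
Hypothesis above_nontrivial : forall x, x \in proper_part P -> nontrivial (above x).
Hypothesis meet_of_proper : forall S, nontrivial S -> meet_of S \in proper_part P.
Hypothesis meet_ofK : forall S, nontrivial S -> above (meet_of S) = S.

Lemma closure_proper x :
  x \in proper_part P -> crosscut_closure x \in proper_part P.
Proof. by move=> /above_nontrivial/meet_of_proper. Qed.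

Lemma carried_bary s : 0 < total_weight s -> carried (bary s).
Proof.
move=> w0; split.
- by move=> x; rewrite divr_ge0 ?(ltW w0) ?sumr_ge0 // => S _; apply: weight_ge0.
- rewrite -mulr_suml -(@partition_big _ _ _ _ _ _ nontrivial meet_of predT) //.
  by rewrite divff // gt_eqF.
- by move=> x /bary_supp[S [pS <- _]]; apply: meet_of_proper.
- move=> x y /bary_supp[S [pS <- wS]] /bary_supp[T [pT <- wT]].
  (* Strict superlevel sets are nested: otherwise both [s j < s i] and [s i < s j]. *)
  apply: meet_of_comparable => i j iS iT jT jS.
  by have := lt_trans (weight_neq0 wS iS jS) (weight_neq0 wT jT iT); rewrite ltxx.
Qed.

(** Each [x] in the support is the meet of a strict superlevel set, which contains [j] as soon as it
    contains [i]. So mass below [e i] is also below [e j]. *)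
Lemma level_bary_homo s i j : 0 < total_weight s ->
  s i <= s j -> level (bary s) i <= level (bary s) j.
Proof.
move=> w0 ij; have [b0 _ _ _] := carried_bary w0.
rewrite /level big_mkcond [leRHS]big_mkcond /=; apply: ler_sum => x _.
have [xi|_] := ifP; last by case: ifP.
case: ifP => // xj; have [->//|/bary_supp[S [pS mS wS]]] := eqVneq (bary s x) 0.
have iS : i \in S by rewrite -(meet_ofK pS) mS inE.
have jS : j \notin S by rewrite -(meet_ofK pS) mS inE xj.
by have := weight_neq0 wS iS jS; rewrite ltNge ij.
Qed.

Lemma carried_neq0 t : carried t -> exists x, t x != 0.
Proof.
move=> [_ t1 _ _].
have [/existsP//|/existsPn h] := boolP [exists x, t x != 0].
have /eqP := t1; rewrite big1 ?(eq_sym 0) ?oner_eq0 // => x _.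
by apply/eqP; move: (h x); rewrite negbK.
Qed.

(** Some [e i] is not above the lowest element of the chain, so the level there is 0; some [e j] is
    above the highest, so the level there is 1. Lowest and highest are measured by the size of
    [above]. *)
Lemma level_nonconst t : carried t -> exists i j, level t i < level t j.
Proof.
move=> ct; have [t0 t1 tP tC] := ct; have [x0 tx0] := carried_neq0 ct.
have [i hi] : exists i, level t i = 0.
  have [x /= tx xmax] := arg_maxnP (fun x => #|above x|) (tx0 : (fun x => t x != 0) x0).
  have /andP[_] := above_nontrivial (tP _ tx); rewrite -finset.subTset => /subsetPn[i _ ix].
  exists i; apply: big1 => y yi; apply/eqP; apply/negPn/negP => ty.
  have xy : above y \subset above x.
    have /orP[/above_anti//|/above_anti yx] := tC _ _ tx ty.
    have : above x == above y by rewrite eqEcard yx xmax.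
    by move/eqP->.
  by case/negP: ix; apply: (fintype.subsetP xy); rewrite inE.
have [j hj] : exists j, level t j = 1.
  have [x /= tx xmin] := arg_minnP (fun x => #|above x|) (tx0 : (fun x => t x != 0) x0).
  have /andP[/finset.set0Pn[j jx] _] := above_nontrivial (tP _ tx).
  exists j; rewrite -t1 /level big_mkcond /=; apply: eq_bigr => y _.
  case: ifPn => // yj; apply/eqP; rewrite eq_sym; apply/negPn/negP => ty.
  have xy : above x \subset above y.
    have /orP[/above_anti yx|/above_anti//] := tC _ _ tx ty.
    have : above y == above x by rewrite eqEcard yx xmin.
    by move/eqP->.
  by case/negP: yj; move: (fintype.subsetP xy _ jx); rewrite inE.
by exists i, j; rewrite hi hj ltr01.
Qed.

(** An element of the chain below [e i] cannot be above [y]; hence it is below [y] and so below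
    [e j]. *)
Lemma level_le t y i j : carried t -> t y != 0 -> (y <= e j)%O ->
  ~~ (y <= e i)%O -> level t i <= level t j.
Proof.
move=> [t0 _ _ tC] ty yj yi.
rewrite /level big_mkcond [leRHS]big_mkcond /=; apply: ler_sum => x _.
have [xi|_] := ifP; last by case: ifP.
case: ifPn => // xj; have [->//|tx] := eqVneq (t x) 0.
have /orP[xy|yx] := tC _ _ tx ty; first by rewrite (le_trans xy yj) in xj.
by rewrite (le_trans yx xi) in yi.
Qed.

(** This lets the closures of the chain of [t] and the support of [bary s] span one simplex. If
    [above x] and a superlevel set of [s] were not nested, the level would increase strictly between
    two indices where [level_le] gives the opposite inequality. *)
Lemma bary_closure_comparable t s x y : carried t ->
  (forall i j, s i < s j -> level t i < level t j) ->
  t x != 0 -> bary s y != 0 ->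
  (crosscut_closure x <= y)%O || (y <= crosscut_closure x)%O.
Proof.
move=> ct st tx /bary_supp[S [pS <- wS]]; apply: meet_of_comparable => i j.
rewrite !inE => xi iS jS xj; have := st _ _ (weight_neq0 wS jS iS).
by rewrite ltNge (level_le ct tx).
Qed.

(* Mass is moved from [x] to its closure starting from the top of the chain:
   after [u] units of mass, what lies strictly above [x] has moved first. *)
Definition moved t (u : R) x : R :=
  Num.min (t x) (Num.max 0 (u - \sum_(y | (x < y)%O) t y)).

Definition push t (u : R) z : R :=
  t z - moved t u z + \sum_(x | crosscut_closure x == z) moved t u x.

Lemma moved_ge0 t u x : 0 <= t x -> 0 <= moved t u x.
Proof. by move=> t0; rewrite le_min t0 le_max lexx. Qed.

Lemma moved_le t u x : moved t u x <= t x.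
Proof. by rewrite ge_min lexx. Qed.

Lemma moved_supp t u x : moved t u x != 0 -> t x != 0.
Proof.
by apply: contraNneq => tx; rewrite /moved tx min_l // le_max lexx.
Qed.

Lemma push_supp t u z : push t u z != 0 ->
  (t z != 0 /\ moved t u z != t z) \/
  (exists2 x, crosscut_closure x = z & moved t u x != 0).
Proof.
move=> h.
have [/existsP[x /andP[/eqP xz mx]]|/existsPn h'] :=
    boolP [exists x, (crosscut_closure x == z) && (moved t u x != 0)].
  by right; exists x.
left; have mtz : moved t u z != t z.
  apply: contraNneq h => mz; rewrite /push mz subrr add0r big1 // => x xz.
  by apply/eqP; move: (h' x); rewrite xz negbK.
split=> //; apply: contraNneq mtz => tz.
by rewrite tz; have [//|/moved_supp] := eqVneq (moved t u z) 0; rewrite tz eqxx.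
Qed.

(** If [x < z], the mass strictly above [x], less than [u] because [x] has begun to move, would
    include the mass at and above [z], more than [u] because [z] has not finished. *)
Lemma moved_order t u x z : carried t ->
  moved t u x != 0 -> t z != 0 -> moved t u z != t z -> (z <= x)%O.
Proof.
move=> [t0 _ _ tC] mx tz mz.
have /orP[//|] := tC _ _ tz (moved_supp mx); rewrite le_eqVlt => /orP[/eqP->//|xz].
have hx : \sum_(y | (x < y)%O) t y < u.
  rewrite ltNge; apply: contra mx => hx.
  by rewrite /moved (max_l (_ : _ - _ <= 0)) ?subr_le0 // min_r.
have hz : u < t z + \sum_(y | (z < y)%O) t y.
  rewrite ltNge; apply: contra mz => hz.
  by rewrite /moved min_l // le_max lerBrDr hz orbT.
suff h : t z + \sum_(y | (z < y)%O) t y <= \sum_(y | (x < y)%O) t y.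
  by have := lt_trans hx (lt_le_trans hz h); rewrite ltxx.
rewrite [leRHS](bigD1 z) //= lerD2l big_mkcond [leRHS]big_mkcond /=.
apply: ler_sum => y _; have [zy|_] := ifP; last by case: ifP.
by rewrite (lt_trans xz zy) (gt_eqF zy).
Qed.

(** By [moved_order], an element that retains mass is below every [x] that has begun to move, hence
    below the closure of [x]; so the support remains a chain. *)
Lemma carried_push t u : carried t -> carried (push t u).
Proof.
move=> ct; have [t0 t1 tP tC] := ct; split.
- move=> z; rewrite addr_ge0 ?subr_ge0 ?moved_le ?sumr_ge0 // => x _.
  exact: moved_ge0.
- rewrite big_split /= -(@partition_big _ _ _ _ _ _ predT crosscut_closure predT) //=.
  by rewrite sumrB subrK.
- move=> z /push_supp[[tz _]|[x <- /moved_supp tx]]; first exact: tP.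
  exact/closure_proper/tP.
- move=> z z' /push_supp[[tz mz]|[x <- mx]] /push_supp[[tz' mz']|[x' <- mx']].
  + exact: tC.
  + by rewrite (le_trans (moved_order ct mx' tz mz) (le_closure _)).
  + by rewrite (le_trans (moved_order ct mx tz' mz') (le_closure _)) orbT.
  + have /orP[/closure_homo->//|/closure_homo->] := tC _ _ (moved_supp mx) (moved_supp mx').
    by rewrite orbT.
Qed.

Lemma push0 t z : carried t -> push t 0 z = t z.
Proof.
move=> [t0 _ _ _].
have m0 x : moved t 0 x = 0.
  rewrite /moved (max_l (_ : _ - _ <= 0)) ?min_r // sub0r oppr_le0.
  exact: sumr_ge0.
by rewrite /push m0 subr0 big1 ?addr0.
Qed.

(** Since 1 is the total mass, every element has finished moving. *)
Lemma push1_supp t z : carried t -> push t 1 z != 0 ->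
  exists2 x, crosscut_closure x = z & t x != 0.
Proof.
move=> [t0 t1 _ _] /push_supp[[_]|[x <- /moved_supp tx]]; last by exists x.
rewrite /moved min_l ?eqxx // le_max lerBrDr; apply/orP; right.
rewrite -t1 [leRHS](bigD1 z) //= lerD2l big_mkcond [leRHS]big_mkcond /=.
apply: ler_sum => y _; have [zy|_] := ifP; last by case: ifP.
by rewrite (gt_eqF zy).
Qed.

(** * Vectors modulo constants, and the maps to and from the unit sphere *)

Definition difference s : 'rV[R]_m := \row_k (s (lift ord0 k) - s ord0).

(** The representative modulo constants that vanishes at [ord0]. *)
Definition undifference (v : 'rV[R]_m) (i : 'I_m.+1) : R :=
  if unlift ord0 i is Some k then v ord0 k else 0.

Definition euclid_norm (v : 'rV[R]_m) : R := Num.sqrt (\sum_k v ord0 k ^+ 2).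

Definition normalize (v : 'rV[R]_m) : 'rV[R]_m :=
  \row_k (v ord0 k / euclid_norm v).

Lemma undifferenceK v : difference (undifference v) = v.
Proof.
by apply/rowP => k; rewrite mxE /undifference liftK unlift_none subr0.
Qed.

Lemma euclid_norm_gt0 v k : v ord0 k != 0 -> 0 < euclid_norm v.
Proof.
move=> vk; rewrite sqrtr_gt0 (bigD1 k) //= ltr_pwDl ?sumr_ge0 //.
  by rewrite lt_neqAle eq_sym sqrf_eq0 vk sqr_ge0.
by move=> l _; apply: sqr_ge0.
Qed.

Lemma difference_norm_gt0 s i j :
  s i < s j -> 0 < euclid_norm (difference s).
Proof.
move=> ij; have [k hk] : exists k, s k != s ord0.
  have [ei|] := eqVneq (s i) (s ord0); last by exists i.
  by exists j; rewrite -ei gt_eqF.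
case: (unliftP ord0 k) hk => [l ->|->]; last by rewrite eqxx.
by move=> hl; apply: (@euclid_norm_gt0 _ l); rewrite mxE subr_eq0.
Qed.

Lemma sphere_normalize v : euclid_norm v != 0 -> unit_sphere (normalize v).
Proof.
move=> v0; rewrite /unit_sphere /=.
have -> : \sum_i normalize v ord0 i ^+ 2 =
    (\sum_i v ord0 i ^+ 2) / euclid_norm v ^+ 2.
  by rewrite mulr_suml; apply: eq_bigr => k _; rewrite mxE expr_div_n.
rewrite sqr_sqrtr ?sumr_ge0 // => [|k _]; last exact: sqr_ge0.
rewrite divff //; apply: contraNneq v0 => v0.
by rewrite /euclid_norm v0 sqrtr0.
Qed.

Lemma normalize_sphere v : unit_sphere v -> normalize v = v.
Proof.
move=> v1; apply/rowP => k.
by rewrite mxE /euclid_norm (v1 : \sum_k _ = _) sqrtr1 divr1.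
Qed.

Lemma undifference_nonconst v : unit_sphere v ->
  exists i j, undifference v i < undifference v j.
Proof.
move=> v1.
have [/existsP[k vk]|/existsPn h] := boolP [exists k, v ord0 k != 0].
  have : undifference v (lift ord0 k) != undifference v ord0.
    by rewrite /undifference liftK unlift_none.
  by rewrite neq_lt => /orP[] h; [exists (lift ord0 k), ord0|exists ord0, (lift ord0 k)].
have /eqP : \sum_k v ord0 k ^+ 2 = 1 := v1.
rewrite big1 ?(eq_sym 0) ?oner_eq0 // => k _.
by move: (h k); rewrite negbK => /eqP->; rewrite expr0n.
Qed.

Lemma undifference_normalize s i :
  undifference (normalize (difference s)) i =
  (s i - s ord0) / euclid_norm (difference s).
Proof.
rewrite /undifference; case: unliftP => [k ->|->]; first by rewrite !mxE.
by rewrite subrr mul0r.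
Qed.

Lemma undifference_order s i j : 0 < euclid_norm (difference s) ->
  (undifference (normalize (difference s)) i <
   undifference (normalize (difference s)) j) = (s i < s j).
Proof.
by move=> n0; rewrite !undifference_normalize ltr_pM2r ?invr_gt0 // ltrD2r.
Qed.

Definition to_sphere t : 'rV[R]_m := normalize (difference (level t)).

Definition of_sphere (v : 'rV[R]_m) : P -> R := bary (undifference v).

Definition sphere_homotopy (p : 'rV[R]_m * R) : 'rV[R]_m :=
  normalize (difference (fun i =>
    (1 - p.2) * level (of_sphere p.1) i + p.2 * undifference p.1 i)).

(** Two phases meet at time 1/2. Before it, a segment leads from the round trip through the sphere
    to [push] at 1; after it, the pushing is undone until the identity is reached at time 1. The
    truncations by [min] and [max] merge the phases into one formula, which makes continuity
    direct. *)
Definition complex_homotopy (p : (P -> R) * R) : P -> R := fun z =>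
  (1 - Num.max 0 (1 - 2 * p.2)) * push p.1 (Num.min 1 (2 - 2 * p.2)) z +
  Num.max 0 (1 - 2 * p.2) * of_sphere (to_sphere p.1) z.

Lemma carried_of_sphere v : unit_sphere v -> carried (of_sphere v).
Proof.
by move=> /undifference_nonconst[i [j /total_weight_gt0]]; apply: carried_bary.
Qed.

Lemma to_sphere_norm_gt0 t : carried t -> 0 < euclid_norm (difference (level t)).
Proof. by move=> /level_nonconst[i [j /difference_norm_gt0]]. Qed.

Lemma unit_sphere_to_sphere t : carried t -> unit_sphere (to_sphere t).
Proof. by move=> /to_sphere_norm_gt0 h; apply: sphere_normalize; rewrite gt_eqF. Qed.

(** The levels of [of_sphere v] increase strictly between some [i] and [j]. By [level_bary_homo] so
    does [undifference v], and then no convex combination of the two is constant. *)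
Lemma sphere_homotopy_norm_gt0 v a : unit_sphere v -> 0 <= a <= 1 ->
  0 < euclid_norm (difference (fun i =>
    (1 - a) * level (of_sphere v) i + a * undifference v i)).
Proof.
move=> v1 a01; have [i [j ij]] := level_nonconst (carried_of_sphere v1).
have [k [l /total_weight_gt0 w0]] := undifference_nonconst v1.
have uij : undifference v i < undifference v j.
  by rewrite ltNge; apply: contraTN ij => h; rewrite -leNgt level_bary_homo.
by apply: (@difference_norm_gt0 _ i j); apply: ltr_convex.
Qed.

Lemma carried_complex_homotopy t a : carried t -> 0 <= a <= 1 ->
  carried (complex_homotopy (t, a)).
Proof.
move=> ct /andP[a0 a1].
have cf : carried (of_sphere (to_sphere t)).
  exact/carried_of_sphere/unit_sphere_to_sphere.
(* For [a >= 1/2] the second term vanishes and only the push remains. *)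
rewrite /complex_homotopy /=; have [ha|ha] := leP (1 - 2 * a) 0.
  rewrite [X in carried X](_ : _ = push t (Num.min 1 (2 - 2 * a))).
    exact: carried_push.
  by apply: boolp.funext => z; rewrite subr0 mul1r mul0r addr0.
(* For [a < 1/2] all mass sits on closures, which are comparable with the support of the image
   point, so the segment stays in the complex. *)
have -> : Num.min 1 (2 - 2 * a) = 1 by rewrite min_l //; lra.
apply: carried_convex => //; [exact: carried_push|by apply/andP; split; lra|].
move=> x y /(push1_supp ct)[z <- tz] hy.
apply: (bary_closure_comparable ct _ tz hy) => i j.
by rewrite undifference_order // to_sphere_norm_gt0.
Qed.

End Crosscut.

(** * Continuity *)

Section Continuity.
Local Open Scope ring_scope.
Local Open Scope classical_set_scope.
Context (R : realType) (X : topologicalType) (p : X).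

(** The topology of pointwise convergence is the supremum of those induced by the evaluations, so
    one coordinate at a time suffices. *)
Lemma continuous_at_ptws (I : Type) (f : X -> {ptws I -> R}) :
  (forall i, {for p, continuous (fun q => f q i : R)}) ->
  {for p, continuous f}.
Proof.
move=> cf; apply/cvg_sup => i A [B [/= [C oC CB] Bfp] BA].
move: Bfp; rewrite -CB /= => Cfp.
by apply: filterS BA _; rewrite -CB; apply: cf; apply: open_nbhs_nbhs.
Qed.

Lemma continuous_at_mx (k l : nat) (f : X -> 'M[R]_(k, l)) :
  (forall i j, {for p, continuous (fun q => f q i j : R)}) ->
  {for p, continuous f}.
Proof.
move=> cf A /= [B hB BA]; apply: filterS BA _.
by apply: filter_forall => i; apply: filter_forall => j; apply: cf; apply: hB.
Qed.

Lemma continuous_at_sum (I : finType) (Q : pred I) (f : I -> X -> R) :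
  (forall i, Q i -> {for p, continuous (f i)}) ->
  {for p, continuous (fun q => \sum_(i | Q i) f i q)}.
Proof. by move=> cf; apply: cvg_big => // ; apply: add_continuous. Qed.

Lemma continuous_at_prod (I : finType) (Q : pred I) (f : I -> X -> R) :
  (forall i, Q i -> {for p, continuous (f i)}) ->
  {for p, continuous (fun q => \prod_(i | Q i) f i q)}.
Proof. by move=> cf; apply: cvg_big => // ; apply: mul_continuous. Qed.

Lemma continuous_at_div (f g : X -> R) : g p != 0 ->
  {for p, continuous f} -> {for p, continuous g} ->
  {for p, continuous (fun q => f q / g q)}.
Proof. by move=> gp cf cg; apply: cvgM => //; apply: cvgV. Qed.

Lemma continuous_at_convex (a f g : X -> R) :
  {for p, continuous a} -> {for p, continuous f} -> {for p, continuous g} ->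
  {for p, continuous (fun q => (1 - a q) * f q + a q * g q)}.
Proof.
move=> ca cf cg; apply: cvgD; apply: cvgM; [|exact: cf|exact: ca|exact: cg].
by apply: cvgB; [exact: cvg_cst|exact: ca].
Qed.

Lemma continuous_at_affine (b c : R) (a : X -> R) :
  {for p, continuous a} -> {for p, continuous (fun q => b - c * a q)}.
Proof.
move=> ca; apply: cvgB; first exact: cvg_cst.
by apply: cvgM; [exact: cvg_cst|exact: ca].
Qed.

Lemma continuous_at_maxl (b : R) (a : X -> R) :
  {for p, continuous a} -> {for p, continuous (fun q => Num.max b (a q))}.
Proof. by apply: (@continuous_max _ _ (fun=> b)); exact: cvg_cst. Qed.

Lemma continuous_at_minl (b : R) (a : X -> R) :
  {for p, continuous a} -> {for p, continuous (fun q => Num.min b (a q))}.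
Proof. by apply: (@continuous_min _ _ (fun=> b)); exact: cvg_cst. Qed.

End Continuity.

(** * Continuity of the maps and homotopies, and the homotopy equivalence *)

Section CrosscutHomotopy.
Local Open Scope ring_scope.
Local Open Scope classical_set_scope.
Context (R : realType) (d : Order.disp_t) (P : finTBLatticeType d).
Context (m : nat) (e : 'I_m.+1 -> P).

Section Maps.
Context (X : topologicalType) (p : X).

Lemma continuous_level (f : X -> P -> R) i :
  (forall x, {for p, continuous (f ^~ x)}) ->
  {for p, continuous (fun q => level e (f q) i)}.
Proof. by move=> cf; apply: continuous_at_sum. Qed.

(** Dividing by [total_weight] is continuous only where it does not vanish, so the claim is local at
    a point [p] with positive total weight. *)
Lemma continuous_bary (f : X -> 'I_m.+1 -> R) x : 0 < total_weight (f p) ->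
  (forall i, {for p, continuous (f ^~ i)}) ->
  {for p, continuous (fun q => bary e (f q) x)}.
Proof.
move=> w0 cf.
have cw S : {for p, continuous (fun q => weight (f q) S)}.
  apply: continuous_at_prod => i _; apply: continuous_at_prod => j _.
  apply: continuous_at_maxl.
  by apply: cvgB; apply: cf.
apply: continuous_at_div; first by rewrite gt_eqF.
  exact: continuous_at_sum.
exact: continuous_at_sum.
Qed.

Lemma continuous_push (f : X -> P -> R) (u : X -> R) z :
  (forall x, {for p, continuous (f ^~ x)}) -> {for p, continuous u} ->
  {for p, continuous (fun q => push e (f q) (u q) z)}.
Proof.
move=> cf cu.
have cm x : {for p, continuous (fun q => moved (f q) (u q) x)}.
  apply: (@continuous_min _ _ (f ^~ x)); first exact: cf.
  apply: continuous_at_maxl.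
  by apply: cvgB; first exact: cu; apply: continuous_at_sum.
apply: cvgD; first by apply: cvgB; [exact: cf|exact: cm].
exact: continuous_at_sum.
Qed.

Lemma continuous_normalize_difference (f : X -> 'I_m.+1 -> R) :
  0 < euclid_norm (difference (f p)) ->
  (forall i, {for p, continuous (f ^~ i)}) ->
  {for p, continuous (fun q => normalize (difference (f q)))}.
Proof.
move=> n0 cf; apply: continuous_at_mx => i k.
have cd l : {for p, continuous (fun q => difference (f q) ord0 l)}.
  rewrite [X in {for _, continuous X}](_ : _ = fun q => f q (lift ord0 l) - f q ord0).
    by apply: cvgB; apply: cf.
  by apply: funext => q; rewrite mxE.
rewrite [X in {for _, continuous X}](_ : _ = fun q =>
    difference (f q) ord0 k / euclid_norm (difference (f q))); last first.
  by apply: funext => q; rewrite mxE.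
apply: continuous_at_div; [by rewrite gt_eqF|exact: cd|].
apply: (@continuous_comp _ _ _ (fun q => \sum_k difference (f q) ord0 k ^+ 2)).
  apply: continuous_at_sum => l _; apply: cvgM; exact: cd.
exact: sqrt_continuous.
Qed.

Lemma continuous_undifference (f : X -> 'rV[R]_m) i :
  {for p, continuous f} -> {for p, continuous (fun q => undifference (f q) i)}.
Proof.
move=> cf; rewrite /undifference; case: unlift => [k|]; last exact: cvg_cst.
apply: (@continuous_comp _ _ _ f (fun M : 'rV[R]_m => M ord0 k)) => //.
exact: coord_continuous.
Qed.

End Maps.

Hypothesis above_nontrivial :
  forall x, x \in proper_part P -> nontrivial (above e x).
Hypothesis meet_of_proper :
  forall S, nontrivial S -> meet_of e S \in proper_part P.
Hypothesis meet_ofK : forall S, nontrivial S -> above e (meet_of e S) = S.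

Lemma continuous_to_sphere (X : topologicalType) (p : X) (f : X -> P -> R) :
  carried (f p) -> (forall x, {for p, continuous (f ^~ x)}) ->
  {for p, continuous (fun q => to_sphere e (f q))}.
Proof.
move=> cp cf; apply: (@continuous_normalize_difference _ _ (fun q => level e (f q))).
  exact: to_sphere_norm_gt0.
by move=> i; apply: continuous_level.
Qed.

Lemma continuous_of_sphere (X : topologicalType) (p : X) (f : X -> 'rV[R]_m) x :
  unit_sphere (f p) -> {for p, continuous f} ->
  {for p, continuous (fun q => of_sphere e (f q) x)}.
Proof.
move=> cp cf; apply: (@continuous_bary _ _ (fun q => undifference (f q))).
  by have [i [j /total_weight_gt0]] := undifference_nonconst cp.
by move=> i; apply: continuous_undifference.
Qed.

Lemma continuous_complex_homotopy (X : topologicalType) (p : X)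
    (f : X -> P -> R) (a : X -> R) z :
  carried (f p) -> (forall x, {for p, continuous (f ^~ x)}) ->
  {for p, continuous a} ->
  {for p, continuous (fun q => complex_homotopy e (f q, a q) z)}.
Proof.
move=> cp cf ca; apply: continuous_at_convex.
- exact/continuous_at_maxl/continuous_at_affine.
- apply: continuous_push; first exact: cf.
  exact/continuous_at_minl/continuous_at_affine.
- apply: (@continuous_of_sphere _ _ (fun q => to_sphere e (f q))).
    exact: unit_sphere_to_sphere.
  exact: continuous_to_sphere.
Qed.

Lemma continuous_sphere_homotopy (X : topologicalType) (p : X)
    (f : X -> 'rV[R]_m) (a : X -> R) :
  unit_sphere (f p) -> 0 <= a p <= 1 -> {for p, continuous f} ->
  {for p, continuous a} ->
  {for p, continuous (fun q => sphere_homotopy e (f q, a q))}.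
Proof.
move=> fp ap cf ca; apply: (@continuous_normalize_difference _ _ (fun q i =>
  (1 - a q) * level e (of_sphere e (f q)) i + a q * undifference (f q) i)).
  exact: sphere_homotopy_norm_gt0.
move=> i; apply: continuous_at_convex => //.
- apply: (@continuous_level _ _ (fun q => of_sphere e (f q))) => x.
  exact: continuous_of_sphere.
- exact: continuous_undifference.
Qed.

Lemma continuous_ptws_at (X : topologicalType) (p : X) (f : X -> {ptws P -> R}) x :
  {for p, continuous f} -> {for p, continuous (fun q => f q x : R)}.
Proof.
move=> cf; apply: (@continuous_comp _ _ _ f (fun t : {ptws P -> R} => t x)) => //.
exact: (@proj_continuous P (fun=> R) x).
Qed.

Theorem crosscut_sphere : homotopy_equivalent R
  (@geometric_realization R P (order_complex (proper_part P)))
  (@unit_sphere R m).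
Proof.
have idc (t : {ptws P -> R}) x : {for t, continuous (fun q : {ptws P -> R} => q x : R)}.
  by apply: (@continuous_ptws_at _ _ id); exact: cvg_id.
have fstc (p : {ptws P -> R} * R) x :
    {for p, continuous (fun q : {ptws P -> R} * R => q.1 x : R)}.
  by apply: (@continuous_ptws_at _ _ fst); exact: cvg_fst.
exists (@to_sphere R d P m e), (@of_sphere R d P m e); split; [split|split| |].
(* Continuity in the whole space at each point of the subset gives continuity of the restriction. *)
- apply: continuous_in_subspaceT => t /set_mem/carriedP ct.
  exact: (@continuous_to_sphere {ptws P -> R} t (fun q => q)).
- by move=> t /carriedP; apply: unit_sphere_to_sphere.
- apply: continuous_in_subspaceT => v /set_mem v1.
  apply: continuous_at_ptws => x; exact: (@continuous_of_sphere 'rV[R]_m v id).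
- by move=> v /(carried_of_sphere meet_of_proper)/carriedP.
- exists (@complex_homotopy R d P m e); split.
  + apply: continuous_in_subspaceT => -[t a] /set_mem[/= /carriedP ct _].
    apply: continuous_at_ptws => z.
    have ca : {for (t, a), continuous (fun q : {ptws P -> R} * R => q.2)} by exact: cvg_snd.
    exact: (@continuous_complex_homotopy _ (t, a) fst snd).
  + move=> [t a] [/= /carriedP ct]; rewrite in_itv /= => a01.
    by apply/carriedP; apply: carried_complex_homotopy.
  + move=> t _; apply: funext => z; rewrite /complex_homotopy /= mulr0 subr0.
    by rewrite max_r // subrr mul0r add0r mul1r.
  + move=> t /carriedP ct; apply: funext => z; rewrite /complex_homotopy /= mulr1.
    rewrite subrr (min_r (_ : 0 <= 1)) // max_l; last by lra.
    by rewrite subr0 mul1r mul0r addr0 push0.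
- exists (@sphere_homotopy R d P m e); split.
  + apply: continuous_in_subspaceT => -[v a] /set_mem[/= v1].
    rewrite /= in_itv /= => a01.
    have ca : {for (v, a), continuous (fun q : 'rV[R]_m * R => q.2)} by exact: cvg_snd.
    have cv : {for (v, a), continuous (fun q : 'rV[R]_m * R => q.1)} by exact: cvg_fst.
    exact: (@continuous_sphere_homotopy _ (v, a) fst snd).
  + move=> [v a] [/= v1]; rewrite in_itv /= => a01.
    by apply: sphere_normalize; rewrite gt_eqF // sphere_homotopy_norm_gt0.
  + move=> v _; rewrite /sphere_homotopy /= /to_sphere; congr (normalize (difference _)).
    by apply: funext => i; rewrite subr0 mul1r mul0r addr0.
  (* At time 1 the segment ends at [undifference v], whose difference is [v], already of norm 1. *)
  + move=> v v1; rewrite /sphere_homotopy /= -[RHS](normalize_sphere v1).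
    rewrite -{3}(undifferenceK v); congr (normalize (difference _)).
    by apply: funext => i; rewrite subrr mul0r mul1r add0r.
Qed.

End CrosscutHomotopy.

(** * Application to the coatoms of a congruence-uniform lattice *)

Theorem theorem1p1 (R : realType) (d : Order.disp_t) (L : finTBLatticeType d) :
  congruence_uniform L -> is_lattice (@clo d L) -> spherical R L.
Proof.
move=> cuL latL; have nT := nucleus_top cuL latL.
have [[injL _] _] := cuL.
pose C := enum [pred y : L | covers y (\top : L)%O].
(* One less than the number of coatoms, because level vectors are taken modulo constants. With no
   coatoms, [m] is again 0 and [e] takes the default value [\top]. *)
pose m := (size C).-1; pose e (i : 'I_m.+1) := nth (\top : L)%O C i.
have memC y : (y \in C) = covers y (\top : L)%O by rewrite mem_enum.
exists m.
(* Without coatoms [L] has one element: its proper part is empty, as is the unit sphere for [m = 0],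
   and a one-element index type has no nontrivial subset. *)
have [C0|C0] := posnP (size C).
  have bt : (\bot : L)%O = (\top : L)%O.
    apply/eqP; apply/negPn/negP => bt.
    have [|u] := @covers_above _ L \bot%O \top%O; first by rewrite lt0x eq_sym.
    by rewrite -memC (size0nil C0).
  have noS (S : {set 'I_m.+1}) : nontrivial S = false.
    have val0 (k : 'I_m.+1) : val k = 0%N by case: k => k /=; rewrite /m C0; case: k.
    apply/negP => /andP[/finset.set0Pn[i iS]]; rewrite -finset.subTset => /subsetPn[j _].
    by rewrite (val_inj (etrans (val0 j) (esym (val0 i)))) iS.
  apply: (@crosscut_sphere R d L m e) => [x|S|S]; rewrite ?noS //.
  by rewrite inE -bt; case/andP => xb xt; have := lex1 x; rewrite -bt lex0 (negbTE xb).
have Cm : m.+1 = size C by rewrite prednK.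
have ce i : covers (e i) (\top : L)%O by rewrite -memC mem_nth // -Cm.
have inje : injective e.
  move=> i j /eqP; rewrite nth_uniq -?Cm ?enum_uniq // => /eqP; exact: val_inj.
have meetK S i : ((meet_of e S <= e i)%O) = (i \in S) by apply: coatom_meet.
apply: (@crosscut_sphere R d L m e) => [x|S|S].
- rewrite inE => /andP[xb xt]; apply/andP; split.
    have [|u cu xu] := @covers_above _ L x \top%O; first by rewrite ltx1.
    apply/finset.set0Pn.
    have uC : u \in C by rewrite memC.
    have iu : (index u C < m.+1)%N by rewrite Cm index_mem.
    by exists (Ordinal iu); rewrite inE /e /= nth_index.
  (* An element below all coatoms is below their meet, the nucleus of [\top], which is [\bot]. *)
  apply: contra xb => /eqP xT; rewrite -lex0 -nT; apply/meetsP => y; rewrite -memC => yC.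
  have iy : (index y C < m.+1)%N by rewrite Cm index_mem.
  by have := finset.in_setT (Ordinal iy); rewrite -xT inE /e /= nth_index.
- case/andP => /finset.set0Pn[i iS]; rewrite -finset.subTset => /subsetPn[j _ jS].
  rewrite inE; apply/andP; split.
    by apply: contraNneq jS => mS; rewrite -meetK mS le0x.
  apply/negP => /eqP mS; have /andP[+ _] := ce i; rewrite -mS.
  by move=> /lt_geF; rewrite meetK iS.
- by move=> _; apply/finset.setP => i; rewrite inE meetK.
Qed.
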